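(* Let $d\ge 3$ be a fixed positive integer. Let $X=X_\tau$ be a family of distance regular graphs of diameter $d$, for which the number of vertices $n=n(\tau)$, the valency $k=k(\tau)$, and the intersection numbers $a_i(\tau),b_i(\tau),c_i(\tau)$ are all functions of a parameter $\tau$ ranging over an unbounded set of positive numbers, and $k(\tau)$ increases in $\tau$. Further assume $$\lim_{\tau\to\infty}\frac{k(\tau)^{d-1}}{n(\tau)}=0.$$ Let $a$ be any vertex of $X$ (the marked vertex). Then, as the valency $k(\tau)$ goes to infinity (with $\tau\to\infty$), the average search probability on $X$ approaches $1/4$.
   Context: Graphs are finite and simple. A connected graph is distance regular if for any two vertices $u,v$ at distance $m$, the number of vertices at distance $i$ from $u$ and distance $j$ from $v$ depends only on $i,j,m$. For a distance regular graph of diameter $d$ and any two vertices $u,v$ at distance $i$, the intersection numbers $c_i$, $a_i$, $b_i$ are the numbers of neighbors of $v$ at distance $i-1$, $i$, $i+1$ from $u$, respectively. Quantum walk: let $X$ be a $k$-regular graph on $n$ vertices with marked vertex $a$. View each edge $\{u,v\}$ as two arcs $(u,v),(v,u)$ and consider complex functions on the $nk$ arcs, identified with $\mathbb{C}^n\otimes\mathbb{C}^k$ by grouping arcs by tail. Let $R$ be the permutation matrix swapping $(u,v)$ and $(v,u)$, $C=I_n\otimes(\frac2kJ_k-I_k)$ (i.e. $(Cf)(u,v)=\frac2k\sum_{w\sim u}f(u,w)-f(u,v)$), and $O_a=(I_n-2E_{aa})\otimes I_k$ (i.e. $O_a$ multiplies $f(u,v)$ by $-1$ if $u=a$ and by $1$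 otherwise). The transition matrix is $U=RCO_a$ and the initial state is $x_0=\frac{1}{\sqrt{nk}}\mathbf{1}_{nk}$, where $\mathbf 1_{nk}$ is the all-ones vector. If $F_r$ are the orthogonal projections onto the eigenspaces of $U$ (one for each distinct eigenvalue), the average search probability is $$\sum_{v\sim a}\sum_r\big|e_{(a,v)}^TF_rx_0\big|^2,$$ which equals $\lim_{T\to\infty}\frac1T\sum_{t=0}^{T-1}\sum_{v\sim a}|e_{(a,v)}^TU^tx_0|^2$. *)

(* Defs.v *)
From mathcomp Require Import all_boot all_order all_algebra.
From mathcomp Require Import spectral complex.
From mathcomp Require Import all_classical all_reals all_analysis.

Set Implicit Arguments.
Unset Strict Implicit.
Unset Printing Implicit Defensive.

Import Order.TTheory GRing.Theory Num.Theory numFieldNormedType.Exports.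
Local Open Scope classical_set_scope.
Local Open Scope ring_scope.

Record sgraph := SGraph {
  vertex :> finType;
  adj : rel vertex;
  adj_sym : symmetric adj;
  adj_irrefl : irreflexive adj }.

Arguments adj {s}.

Definition is_connected (X : sgraph) : Prop :=
  (0 < #|X|)%N /\ forall u v : X, connect adj u v.

Definition is_regular (X : sgraph) (k : nat) : Prop :=
  forall u : X, #|[set v | adj u v]%SET| = k.

Definition walk (X : sgraph) (m : nat) (u v : X) : bool :=
  [exists p : m.-tuple X, path adj u p && (last u p == v)].

(* The least length of a walk from u to v. A shortest walk has length less
   than #|X|; the junk value #|X| means that there is no walk at all. *)
Definition dist (X : sgraph) (u v : X) : nat :=
  find (fun m => walk m u v) (iota 0 #|X|).

Definition diameter (X : sgraph) : nat :=
  \max_(u : X) \max_(v : X) dist u v.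

Definition distance_regular (X : sgraph) : Prop :=
  is_connected X /\
  forall (i j : nat) (u v u' v' : X), dist u v = dist u' v' ->
    #|[set w | (dist u w == i) && (dist v w == j)]%SET|
    = #|[set w | (dist u' w == i) && (dist v' w == j)]%SET|.

(* (dist u w).+1 == i expresses "distance i - 1" without truncation at i = 0,
   so that c 0 = 0. *)
Definition intersection_numbers (X : sgraph) (a b c : nat -> nat) : Prop :=
  forall u v : X, let i := dist u v in
  [/\ #|[set w | adj v w && ((dist u w).+1 == i)]%SET| = c i,
      #|[set w | adj v w && (dist u w == i)]%SET| = a i &
      #|[set w | adj v w && (dist u w == i.+1)]%SET| = b i].

Definition dart (X : sgraph) : finType := {p : X * X | adj p.1 p.2}.

Definition dart_tail (X : sgraph) (p : dart X) : X := (val p).1.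
Definition dart_head (X : sgraph) (p : dart X) : X := (val p).2.

Section Walk.
Variables (R : realType) (X : sgraph).
Local Notation C := R[i].

(* Functions on arcs are column vectors, and operators act on them from the
   left; the i-th coordinate belongs to the arc [enum_val i]. *)
Definition dart_mx (F : dart X -> dart X -> C) : 'M[C]_#|dart X| :=
  \matrix_(i, j) F (enum_val i) (enum_val j).

Definition reversal : 'M[C]_#|dart X| :=
  dart_mx (fun p q => ((dart_tail p == dart_head q) && (dart_head p == dart_tail q))%:R).

(* I_n (x) (2/k J_k - I_k), the arcs being grouped by their tails. *)
Definition coin (k : nat) : 'M[C]_#|dart X| :=
  dart_mx (fun p q => (dart_tail p == dart_tail q)%:R * (2%:R / k%:R) - (p == q)%:R).

(* (I_n - 2 E_aa) (x) I_k *)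
Definition oracle (a : X) : 'M[C]_#|dart X| :=
  dart_mx (fun p q => (p == q)%:R * (1 - 2%:R * (dart_tail p == a)%:R)).

Definition transition (k : nat) (a : X) : 'M[C]_#|dart X| :=
  reversal *m coin k *m oracle a.

Definition initial_state (k : nat) : 'cV[C]_#|dart X| :=
  const_mx (sqrtC (#|X| * k)%:R)^-1.

End Walk.

Section Spectral.
Variables (R : realType) (n : nat).
Local Notation C := R[i].

(* The library's eigenvalue, eigenspace and proj_ortho act on row vectors from
   the right; the transpositions turn them into statements about columns. *)
Definition eigenvalues (M : 'M[C]_n) : set C :=
  [set lam | eigenvalue M^T lam].

Definition eigenprojection (M : 'M[C]_n) (lam : C) : 'M[C]_n :=
  (proj_ortho (eigenspace M^T lam))^T.

End Spectral.

(* The neighbours v of a are enumerated through the arcs (a, v). The inner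
   finitely supported sum has one term for each distinct eigenvalue. *)
Definition average_search_probability (R : realType) (X : sgraph) (k : nat)
    (a : X) : R :=
  let U := transition R k a in
  \sum_(i < #|dart X| | dart_tail (enum_val i) == a)
    \sum_(lam \in eigenvalues U)
      Normc.normc ((eigenprojection U lam *m initial_state R X k) i 0) ^+ 2.

(* Main.v *)
Require Import Defs.
From mathcomp Require Import all_boot all_order all_algebra.
From mathcomp Require Import all_classical all_reals all_analysis.
From mathcomp Require Import spectral complex ring lra zify.

(** Write [P] for the random walk on [X] and suppose that [y] vanishes at the
    marked vertex [a], equals 1 on the neighbours of [a], and satisfies
    [P y = mu y] away from [a], where [mu = 1 - eps]. Let [Y] be the function
    on arcs with value [y u] on every arc leaving [u], and [Z] its image under
    the reversal of arcs. Then [U Y = Z] and [U Z = 2 mu Z - Y], so the plane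
    spanned by [Y] and [Z] carries two eigenvectors [Y - lam Z] of the walk,
    with eigenvalues [lam] = exp(+- i theta), cos theta = [mu]; all other
    eigenprojections vanish on this plane. On the [k] arcs
    leaving [a] the function [Y] vanishes and [Z] is 1, so all contributions of
    [Y] to the search probability can be computed: for the state
    [Y / sqrt (n k)] the sum is 1 / (2 n eps (2 - eps)).

    In the family at hand such a [y] exists and is nearly constant. Among the
    functions of the distance from [a], the eigenvalue equation is a three-term
    recurrence in which the flux [Phi_i] from the sphere of radius [i] to that
    of radius [i - 1] decreases by [eps k_i y_i] at each step, with [k_i] the
    size of the sphere. Solutions of the boundary problem are found by shooting:
    [eps] is a zero of the least flux ([exists_ground_state]). All fluxes lie
    between 0 and 1, so [y] increases by at most [k / (k_i c_i)] at step [i],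
    and since [k_d <= k_i k^(d-i)] this is at most [k^(d-1) / k_d] for
    [i >= 2]. As all spheres but the last together have at most [d k^(d-1)]
    vertices, [k_d] is nearly [n] and [y] is nearly 1 outside [a]
    ([radial_ground_state]). Summing the eigenvalue equation over the graph
    gives [eps * sum_u y u = 1] ([eigen_mass]), so [n eps] tends to 1 and
    1 / (2 n eps (2 - eps)) to 1/4.

    The initial state differs from [Y / sqrt (n k)] by a vector whose norm tends
    to 0. The entries of all eigenprojections of a vector form a family whose
    norm is at most that of the vector (Bessel), so the search probabilities of
    the two states have the same limit ([block_weight_perturb]). *)

Set Implicit Arguments.
Unset Strict Implicit.
Unset Printing Implicit Defensive.

Import Order.TTheory GRing.Theory Num.Theory numFieldNormedType.Exports.
Local Open Scope classical_set_scope.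
Local Open Scope ring_scope.

(** * Eigenprojections of a unitary matrix *)

Section UnitaryEigenprojections.
Local Open Scope sesquilinear_scope.

(** The difference of the two sides is the square norm of
    [v - \sum_(i <- r) u i]. *)
Lemma bessel (C : numClosedFieldType) n (I : eqType) (r : seq I)
    (u : I -> 'rV[C]_n) (v : 'rV[C]_n) :
  uniq r ->
  (forall i j, i != j -> u i *m (u j)^t* = 0) ->
  (forall i, v *m (u i)^t* = u i *m (u i)^t*) ->
  \sum_(i <- r) (u i *m (u i)^t*) 0 0 <= (v *m v^t*) 0 0.
Proof.
move=> r_uniq u_orth vu.
pose s := \sum_(i <- r) u i.
have dot_s w : w *m s^t* = \sum_(i <- r) w *m (u i)^t*.
  by rewrite /s linear_sum map_mx_sum mulmx_sumr.
have vs : v *m s^t* = \sum_(i <- r) u i *m (u i)^t*.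
  by rewrite dot_s; apply: eq_bigr => i _; exact: vu.
have ss : s *m s^t* = \sum_(i <- r) u i *m (u i)^t*.
  rewrite dot_s; apply: eq_big_seq => i ir.
  rewrite /s mulmx_suml (bigD1_seq i) //= big1 ?addr0// => j ji.
  exact: u_orth.
have sv : s *m v^t* = \sum_(i <- r) u i *m (u i)^t*.
  rewrite -ss -[RHS]trmxCK -[LHS]trmxCK; congr (_ ^t*).
  by rewrite !trmx_mul !map_mxM !trmxCK vs ss.
have : 0 <= ((v - s) *m (v - s)^t*) 0 0.
  by rewrite mxE sumr_ge0// => i _; rewrite !mxE mul_conjC_ge0.
rewrite linearB /= map_mxB mulmxBl !mulmxBr vs ss sv subrr subr0.
by rewrite !mxE subr_ge0 summxE.
Qed.

(** [N] preserves the hermitian product, hence multiplies the product of [v]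
    with a row of [W] by 1; as these are eigenvectors it also multiplies it by
    [lam * mu^*], which is not 1 because [lam] lies on the unit circle when
    [v] is nonzero. *)
Lemma unitary_eigenvectors_orthogonal (C : numClosedFieldType) n (N : 'M[C]_n)
    (lam mu : C) q (v : 'rV[C]_n) (W : 'M[C]_(q, n)) :
  N \is unitarymx -> lam != mu ->
  (v <= eigenspace N lam)%MS -> (W <= eigenspace N mu)%MS -> v *m W^t* = 0.
Proof.
move=> N_unitary lam_mu /eigenspaceP vN /eigenspaceP WN.
have N_isom m p (A : 'M[C]_(m, n)) (B : 'M[C]_(p, n)) :
    (A *m N) *m (B *m N)^t* = A *m B^t*.
  by rewrite trmx_mul map_mxM mulmxA mulmxtVK.
have [->|v0] := eqVneq v 0; first by rewrite mul0mx.
have lam_unit : lam * lam^* = 1.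
  have : dotmx v v != 0 by rewrite gt_eqF// dotmx_is_dotmx.
  rewrite dotmxE => vv0; apply: (mulIf vv0); rewrite mul1r.
  rewrite -[in RHS]N_isom vN linearZ /= map_mxZ -scalemxAl -scalemxAr scalerA.
  by rewrite [in RHS]mxE.
have /eqP : (lam * mu^* - 1) *: (v *m W^t*) = 0.
  rewrite scalerBl scale1r -[in X in _ - X]N_isom vN WN linearZ /= map_mxZ.
  by rewrite -scalemxAl -scalemxAr scalerA subrr.
rewrite scaler_eq0 subr_eq0 => /orP[/eqP lam_mu1|/eqP //].
case/eqP: lam_mu; apply: (can_inj conjCK).
have lam0 : lam != 0.
  apply/eqP => lam0; move: lam_unit; rewrite lam0 mul0r => /esym/eqP.
  by rewrite oner_eq0.
by apply: (mulfI lam0); rewrite lam_unit lam_mu1.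
Qed.

End UnitaryEigenprojections.

Section Projections.
Local Open Scope sesquilinear_scope.
Variables (R : realType) (n : nat).
Local Notation C := R[i].
Implicit Types (M : 'M[C]_n) (x y : 'cV[C]_n).

Definition sqnorm x : R := \sum_i Normc.normc (x i 0) ^+ 2.

Lemma sqnormE x : (sqnorm x)%:C%C = (x^T *m (x^T)^t*) 0 0.
Proof.
rewrite /sqnorm mxE rmorph_sum; apply: eq_bigr => i _ /=.
rewrite !mxE -normCK rmorphXn; congr (_ ^+ _).
Qed.

Lemma sqnormN x : sqnorm (- x) = sqnorm x.
Proof.
by apply: eq_bigr => i _; rewrite mxE; case: (x i 0) => z1 z2; rewrite /= !sqrrN.
Qed.

(** This turns the finitely supported sums over the set of eigenvalues into
    sums over a sequence. *)
Lemma eigenvalue_seq M :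
  exists r : seq C, uniq r /\ eigenvalues M = [set` r].
Proof.
have [r r_roots] := closed_field_poly_normal (char_poly M^T).
exists (undup r); split; first exact: undup_uniq.
apply/seteqP; split => lam /=;
  rewrite /eigenvalues /= eigenvalue_root_char r_roots mem_undup;
  by rewrite (monicP (char_poly_monic _)) scale1r root_prod_XsubC.
Qed.

Lemma eigenprojection_eigen M lam x :
  M *m x = lam *: x -> eigenprojection M lam *m x = x.
Proof.
move=> Mx; apply: trmx_inj; rewrite trmx_mul trmxK proj_ortho_id//.
by apply/eigenspaceP; rewrite -trmx_mul Mx linearZ.
Qed.

Lemma eigenprojection_other M lam mu x : M \is unitarymx -> lam != mu ->
  M *m x = mu *: x -> eigenprojection M lam *m x = 0.
Proof.
move=> M_unitary lam_mu Mx; apply: trmx_inj; rewrite trmx_mul !trmxK trmx0.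
rewrite proj_ortho_0// orthomx1E; apply/eqP.
apply: (@unitary_eigenvectors_orthogonal _ _ M^T mu lam);
  rewrite ?trmx_unitary 1?eq_sym//.
by apply/eigenspaceP; rewrite -trmx_mul Mx linearZ.
Qed.

Lemma eigenprojection_sum2 M lam1 lam2 c1 c2 v1 v2 x :
  M \is unitarymx -> lam1 != lam2 ->
  M *m v1 = lam1 *: v1 -> M *m v2 = lam2 *: v2 -> x = c1 *: v1 + c2 *: v2 ->
  [/\ eigenprojection M lam1 *m x = c1 *: v1,
      eigenprojection M lam2 *m x = c2 *: v2 &
      forall lam, lam \notin [:: lam1; lam2] -> eigenprojection M lam *m x = 0].
Proof.
move=> M_unitary lam12 eig1 eig2 ->.
split=> [||lam]; rewrite mulmxDr -!scalemxAr.
- rewrite (eigenprojection_eigen eig1).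
  by rewrite (eigenprojection_other M_unitary lam12 eig2) scaler0 addr0.
- rewrite (eigenprojection_eigen eig2) eq_sym in lam12 *.
  by rewrite (eigenprojection_other M_unitary lam12 eig1) scaler0 add0r.
rewrite !inE negb_or => /andP[ne1 ne2].
rewrite (eigenprojection_other M_unitary ne1 eig1).
by rewrite (eigenprojection_other M_unitary ne2 eig2) !scaler0 addr0.
Qed.

Lemma sum_eigenprojections_le M x : M \is unitarymx ->
  \sum_(lam \in eigenvalues M) sqnorm (eigenprojection M lam *m x) <= sqnorm x.
Proof.
move=> M_unitary; have [r [r_uniq ->]] := eigenvalue_seq M.
rewrite -fsbig_seq// -lecR rmorph_sum sqnormE.
rewrite (eq_bigr _ (fun lam _ => sqnormE _)).
under eq_bigr do rewrite trmx_mul trmxK.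
apply: bessel => // [lam mu lam_mu|lam].
  apply: (@unitary_eigenvectors_orthogonal _ _ M^T lam mu);
    by rewrite ?trmx_unitary// proj_ortho_sub.
apply/eqP; rewrite -subr_eq0 -mulmxBl; apply/eqP.
set P := proj_ortho _.
have := proj_ortho_compl_sub (eigenspace M^T lam) x^T.
rewrite orthomx1E => /eqP.
have : (x^T *m P <= eigenspace M^T lam)%MS by exact: proj_ortho_sub.
move=> /submxP[D ->] res_orth.
by rewrite trmx_mul map_mxM mulmxA res_orth mul0mx.
Qed.

(** The average search probability is the weight of the initial state on the
    block of arcs that leave the marked vertex. Leaving the state free allows
    the initial state to be replaced by one whose weight is computable. *)
Definition block_weight M (Q : pred 'I_n) x : R :=
  \sum_(i | Q i) \sum_(lam \in eigenvalues M)
    Normc.normc ((eigenprojection M lam *m x) i 0) ^+ 2.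

(** Young's inequality bounds each entry of the eigenprojections of [x + y] by
    those of [x] and [y]; the entries of [y] add up to at most [sqnorm y] by
    Bessel's inequality. A bound with a free [t] is the form of the triangle
    inequality between the square roots of the weights that avoids them. *)
Lemma block_weight_perturb M (Q : pred 'I_n) x y (t : R) :
  M \is unitarymx -> 0 < t ->
  block_weight M Q (x + y) <=
    (1 + t) * block_weight M Q x + (1 + t^-1) * sqnorm y.
Proof.
move=> M_unitary t0.
have young (u v : C) : Normc.normc (u + v) ^+ 2 <=
    (1 + t) * Normc.normc u ^+ 2 + (1 + t^-1) * Normc.normc v ^+ 2.
  have normc_ge0 (z : C) : 0 <= Normc.normc z.
    by case: z => z1 z2; rewrite sqrtr_ge0.
  apply: (@le_trans _ _ ((Normc.normc u + Normc.normc v) ^+ 2)).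
    by rewrite lerXn2r// ?nnegrE ?addr_ge0// le_normcD.
  rewrite -subr_ge0.
  set p := Normc.normc u; set q := Normc.normc v.
  have -> : (1 + t) * p ^+ 2 + (1 + t^-1) * q ^+ 2 - (p + q) ^+ 2
      = t^-1 * (t * p - q) ^+ 2 by field; rewrite gt_eqF.
  by rewrite mulr_ge0 ?invr_ge0 ?sqr_ge0// ltW.
have := sum_eigenprojections_le y M_unitary.
rewrite /block_weight; have [r [r_uniq ->]] := eigenvalue_seq M => bessel_y.
rewrite -(ler_pM2l (_ : 0 < 1 + t^-1)) in bessel_y; last first.
  by rewrite addr_gt0 ?invr_gt0.
rewrite -fsbig_seq// in bessel_y.
have weightE z : \sum_(i | Q i) \sum_(lam \in [set` r])
      Normc.normc ((eigenprojection M lam *m z) i 0) ^+ 2 =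
    \sum_(lam <- r) \sum_(i | Q i)
      Normc.normc ((eigenprojection M lam *m z) i 0) ^+ 2.
  rewrite [RHS]exchange_big; apply: eq_bigr => i _; exact/esym/fsbig_seq.
rewrite !weightE; apply: le_trans (lerD (lexx _) bessel_y).
rewrite !mulr_sumr -big_split/=; apply: ler_sum => lam _.
set P := eigenprojection M lam; rewrite mulmxDr.
apply: (@le_trans _ _ (\sum_(i | Q i) ((1 + t) * Normc.normc ((P *m x) i 0) ^+ 2
   + (1 + t^-1) * Normc.normc ((P *m y) i 0) ^+ 2))).
  by apply: ler_sum => i _; rewrite mxE.
rewrite big_split/= -!mulr_sumr lerD2l ler_pM2l ?addr_gt0 ?invr_gt0//.
rewrite /sqnorm [leRHS](bigID Q)/= lerDl sumr_ge0// => i _; exact: sqr_ge0.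
Qed.

End Projections.

(** * Ground state of a weighted path *)

Section Shooting.
Variables (R : realType) (d : nat) (w g : nat -> R).
Implicit Types (eps : R) (i : nat).

(** [shot eps i] is the pair of the height [y_i] and of the flux
    [g_i * (y_i - y_(i-1))] of the solution started from height 0 with flux 1,
    for vertex weights [w], conductances [g] and eigenvalue [eps]. *)
Fixpoint shot eps i : R * R :=
  if i is j.+1 then
    let: (y, phi) := shot eps j in
    let phi' := phi - eps * w j * y in (y + phi' / g i, phi')
  else (0, 1).

Lemma shotS eps i : shot eps i.+1 =
  ((shot eps i).1 + (shot eps i.+1).2 / g i.+1,
   (shot eps i).2 - eps * w i * (shot eps i).1).
Proof. by rewrite /=; case: (shot eps i). Qed.

Fixpoint least_flux eps i : R :=
  if i is j.+1 then Num.min (least_flux eps j) (shot eps i).2 else 1.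

Lemma shot_continuous i :
  continuous (fun eps => (shot eps i).1) /\ continuous (fun eps => (shot eps i).2).
Proof.
elim: i => [|i [y_cont phi_cont]]; first by split=> eps; exact: cst_continuous.
have phi'_cont : continuous (fun eps => (shot eps i.+1).2).
  have -> : (fun eps => (shot eps i.+1).2) =
    (fun eps => (shot eps i).2 - eps * w i * (shot eps i).1).
    by apply/funext => eps; rewrite shotS.
  move=> eps; apply: cvgB; first exact: phi_cont.
  by apply: cvgM; [apply: cvgM; [exact: cvg_id|exact: cvg_cst]|exact: y_cont].
split=> //.
have -> : (fun eps => (shot eps i.+1).1) =
  (fun eps => (shot eps i).1 + (shot eps i.+1).2 / g i.+1).
  by apply/funext => eps; rewrite [in LHS]shotS.
move=> eps; apply: cvgD; first exact: y_cont.
by apply: cvgM; [exact: phi'_cont|exact: cvg_cst].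
Qed.

Lemma least_flux_continuous i : continuous (fun eps => least_flux eps i).
Proof.
elim: i => [|i IH] eps; first exact: cst_continuous.
apply: (@continuous_min _ _ (least_flux^~ i) (fun eps => (shot eps i.+1).2));
  [exact: IH|exact: (shot_continuous i.+1).2].
Qed.

Lemma least_flux_le eps m i : (i <= m)%N -> least_flux eps m <= (shot eps i).2.
Proof.
elim: m => [|m IH]; first by rewrite leqn0 => /eqP ->.
rewrite leq_eqVlt => /orP[/eqP ->|/IH /= H]; rewrite ge_min; apply/orP.
  by right.
by left.
Qed.

Lemma least_flux_attained eps m :
  exists2 i, (i <= m)%N & least_flux eps m = (shot eps i).2.
Proof.
elim: m => [|m [i im IH]]; first by exists 0%N.
rewrite /= -/(shot eps m.+1) minEle.
case: ifP => _; last by exists m.+1.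
by exists i => //; exact: leqW.
Qed.

(** Shooting for a solution whose flux vanishes after the last vertex. The least
    of the fluxes is 1 for [eps = 0] and at most 0 for [eps = 1 / w 1], so it
    vanishes for some [eps] in between. At that value the fluxes are nonnegative,
    hence the heights are at least 1 and the fluxes strictly decreasing; so only
    the flux past the last vertex can be the one that vanishes. The increments
    of [y] are fluxes divided by conductances, and fluxes are at most 1. *)
Lemma exists_ground_state :
  (0 < d)%N ->
  (forall i, (1 <= i <= d)%N -> 0 < w i) ->
  (forall i, (1 <= i <= d)%N -> 0 < g i) ->
  g 1%N = 1 -> g d.+1 = 0 ->
  exists (eps : R) (y : nat -> R),
    [/\ 0 < eps, y 0%N = 0, y 1%N = 1,
      (forall i, (1 <= i < d)%N -> y i <= y i.+1 <= y i + (g i.+1)^-1) &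
      (forall i, (1 <= i <= d)%N ->
         g i * (y i - y i.-1) - g i.+1 * (y i.+1 - y i) = eps * w i * y i)].
Proof.
move=> d0 w0 g0 g1 gd.
have w1 : 0 < w 1%N by apply: w0.
have flux0 i : (shot 0 i).2 = 1.
  by elim: i => [//|i IH]; rewrite shotS/= IH !mul0r subr0.
have [eps eps_in flux_eps] :
    exists2 eps, eps \in `[0, (w 1%N)^-1] & least_flux eps d.+1 = 0.
  apply: IVT; first by rewrite invr_ge0 ltW.
    exact/continuous_subspaceT/least_flux_continuous.
  have -> : least_flux 0 d.+1 = 1.
    by have [i _ ->] := least_flux_attained 0 d.+1; exact: flux0.
  (* the flux after the first vertex is [1 - eps * w 1] *)
  have flux1 : least_flux (w 1%N)^-1 d.+1 <= 0.
    apply: (@le_trans _ _ (shot (w 1%N)^-1 2).2); first exact: least_flux_le.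
    rewrite /= g1 divr1 !mulr0 !subr0 add0r mulr1.
    by rewrite mulVf ?gt_eqF// subrr.
  by rewrite ge_min le_max flux1 ler01 orbT.
have eps_ge0 : 0 <= eps by move: eps_in; rewrite in_itv/= => /andP[].
have eps_gt0 : 0 < eps.
  rewrite lt_def eps_ge0 andbT; apply/eqP => eps0; move: flux_eps; rewrite eps0.
  have [i _ ->] := least_flux_attained 0 d.+1; rewrite flux0 => /eqP.
  by rewrite oner_eq0.
pose y i := (shot eps i).1; pose phi i := (shot eps i).2.
have phi_ge0 i : (i <= d.+1)%N -> 0 <= phi i.
  by move=> id; rewrite -flux_eps least_flux_le.
have phiS i : phi i.+1 = phi i - eps * w i * y i by rewrite /phi shotS.
have yS i : y i.+1 = y i + phi i.+1 / g i.+1 by rewrite /y [in LHS]shotS.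
have y0 : y 0%N = 0 by [].
have phi1 : phi 1%N = 1 by rewrite phiS y0 mulr0 subr0.
have y1 : y 1%N = 1 by rewrite yS y0 phi1 g1 divr1 add0r.
have y_mono i : (1 <= i < d)%N -> y i <= y i.+1.
  move=> /andP[i0 id]; rewrite yS lerDl; apply: divr_ge0.
    by apply: phi_ge0; rewrite ltnS ltnW.
  by rewrite ltW// g0.
have y_ge1 i : (1 <= i <= d)%N -> 1 <= y i.
  elim: i => [//|[|i] IH id]; first by rewrite y1.
  by apply: le_trans (IH _) (y_mono i.+1 id); exact: ltnW.
have phi_le1 i : (i <= d.+1)%N -> phi i <= 1.
  elim: i => [//|[|i] IH id]; first by rewrite phi1.
  apply: le_trans (IH (ltnW id)); rewrite phiS gerBl !mulr_ge0// ltW//.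
    exact: w0.
  by apply: lt_le_trans (y_ge1 _ _).
have phid : phi d.+1 = 0.
  have [i id phii] := least_flux_attained eps d.+1.
  rewrite flux_eps -/(phi i) in phii.
  move: id; rewrite leq_eqVlt => /orP[/eqP <-//|]; rewrite ltnS => id.
  case: i => [|i] in phii id *.
    by move/eqP: phii; rewrite eq_sym oner_eq0.
  have := phi_ge0 i.+2 id; rewrite phiS -phii sub0r oppr_ge0 leNgt.
  by rewrite !mulr_gt0// ?w0// (lt_le_trans ltr01) ?y_ge1.
have flux i : (1 <= i <= d)%N -> g i * (y i - y i.-1) = phi i.
  case: i => // i id; rewrite yS addrC addKr mulrC divfK//.
  by rewrite gt_eqF// g0.
exists eps, y; split=> // i /[dup] id /andP[i0 i_le].
  rewrite y_mono// yS lerD2l; apply: ler_piMl; last by rewrite phi_le1// ltnS ltnW.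
  by rewrite invr_ge0 ltW// g0.
rewrite flux//; move: i_le; rewrite leq_eqVlt => /orP[/eqP E|i_lt].
  by rewrite E gd mul0r subr0 -[LHS]subr0 -phid phiS; ring.
by rewrite (flux i.+1)// phiS; ring.
Qed.

End Shooting.

(** * The walk operators as maps of arc functions *)

Section ArcOperators.
Local Open Scope sesquilinear_scope.
Variables (R : realType) (X : sgraph).
Local Notation C := R[i].
Implicit Types (F : dart X -> dart X -> C) (f : dart X -> C) (p q : dart X).

Definition dart_cv f : 'cV[C]_#|dart X| := \col_i f (enum_val i).

Lemma dart_cvP (x : 'cV[C]_#|dart X|) : exists f, x = dart_cv f.
Proof.
exists (fun p => x (enum_rank p) 0); apply/colP => i.
by rewrite mxE enum_valK.
Qed.

Lemma big_dart (V : nmodType) (P : pred (dart X)) (f : dart X -> V) :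
  \sum_(i < #|dart X| | P (enum_val i)) f (enum_val i) = \sum_(p | P p) f p.
Proof.
rewrite [RHS](reindex (@enum_val (dart X) predT))//.
exact/onW_bij/enum_val_bij.
Qed.

Lemma dart_mx_cv F f :
  dart_mx F *m dart_cv f = dart_cv (fun p => \sum_q F p q * f q).
Proof.
apply/colP => i; rewrite !mxE -big_dart; apply: eq_bigr => j _.
by rewrite !mxE.
Qed.

(** Reversal, coin and oracle are hermitian involutions, and such matrices are
    unitary. *)
Lemma dart_mx_unitary F :
  (forall p q, (F q p)^* = F p q) ->
  (forall f, dart_mx F *m (dart_mx F *m dart_cv f) = dart_cv f) ->
  dart_mx F \is unitarymx.
Proof.
move=> F_herm F_inv; apply/unitarymxP.
have -> : (dart_mx F)^t* = dart_mx F.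
  by apply/matrixP => i j; rewrite !mxE F_herm.
apply/matrixP => i j; have [f fE] := dart_cvP (col j 1%:M).
have := F_inv f; rewrite -fE mulmxA => /colP/(_ i).
by rewrite colE mulmxA mulmx1 -!colE !mxE.
Qed.

Lemma sum_darts_from (V : nmodType) (u : X) (f : X -> V) :
  \sum_(p : dart X | dart_tail p == u) f (dart_head p) = \sum_(w | adj u w) f w.
Proof.
rewrite [RHS](reindex_omap (@dart_head X) (fun w => insub (u, w))); last first.
  by move=> w uw; rewrite insubT.
apply: eq_bigl => -[[v w] /= vw]; rewrite /dart_tail /dart_head /=.
apply/eqP/andP => [vu|[uw]].
  case: u / vu; split=> //; apply/eqP.
  by rewrite insubT; congr Some; exact: val_inj.
by case: insubP => // q _ qE /eqP[qp]; move: qE; rewrite qp => -[].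
Qed.

Lemma card_darts_from (k : nat) (u : X) :
  is_regular X k -> \sum_(p : dart X | dart_tail p == u) (1 : R) = k%:R.
Proof.
move=> X_reg; rewrite (sum_darts_from u (fun _ => 1 : R)) -(X_reg u).
by rewrite cardsE -sum1_card natr_sum; apply: eq_bigl.
Qed.

Definition dart_rev p : dart X :=
  exist (fun e : X * X => is_true (adj e.1 e.2)) ((val p).2, (val p).1)
    (etrans (adj_sym _ _) (valP p)).

Lemma dart_revK : involutive dart_rev.
Proof. by move=> p; apply: val_inj; case: p => -[]. Qed.

Lemma reversal_cv f : reversal R X *m dart_cv f = dart_cv (f \o dart_rev).
Proof.
rewrite dart_mx_cv; apply/colP => i; rewrite !mxE.
set p := enum_val i.
rewrite (bigD1 (dart_rev p))//= big1 ?addr0; last first.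
  move=> q qp; rewrite -[RHS](mul0r (f q)); congr (_ * _).
  case: eqP => [pq1|//]; case: eqP => [pq2|//]; case/eqP: qp.
  apply: val_inj; case: q pq1 pq2 => -[q1 q2] /= ?.
  by rewrite /dart_tail/dart_head/= => -> ->.
by rewrite /dart_tail/dart_head/= !eqxx mul1r.
Qed.

Lemma coin_cv (k : nat) f :
  coin R X k *m dart_cv f =
  dart_cv (fun p =>
    2%:R / k%:R * (\sum_(q | dart_tail q == dart_tail p) f q) - f p).
Proof.
rewrite dart_mx_cv; apply/colP => i; rewrite !mxE; set p := enum_val i.
under eq_bigr do rewrite mulrBl.
rewrite sumrB; congr (_ - _); last first.
  rewrite (bigD1 p)//= eqxx mul1r big1 ?addr0// => q.
  by rewrite eq_sym => /negPf->; rewrite mul0r.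
rewrite mulr_sumr [RHS]big_mkcond; apply: eq_bigr => q _.
by rewrite [dart_tail q == _]eq_sym; case: ifP => _; rewrite (mul1r, mul0r) ?mul0r.
Qed.

Lemma oracle_cv (a : X) f :
  oracle R a *m dart_cv f =
  dart_cv (fun p => (1 - 2%:R * (dart_tail p == a)%:R) * f p).
Proof.
rewrite dart_mx_cv; apply/colP => i; rewrite !mxE; set p := enum_val i.
rewrite (bigD1 p)//= eqxx mul1r big1 ?addr0// => q.
by rewrite eq_sym => /negPf->; rewrite !mul0r.
Qed.

Lemma transition_unitary (k : nat) (a : X) :
  (0 < k)%N -> is_regular X k -> transition R k a \is unitarymx.
Proof.
move=> k0 X_reg; have kC0 : k%:R != 0 :> C by rewrite pnatr_eq0 -lt0n.
apply: mul_unitarymx; first apply: mul_unitarymx.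
- apply: dart_mx_unitary => [p q|f].
    by rewrite rmorph_nat andbC [X in _ && X]eq_sym [X in X && _]eq_sym.
  rewrite !reversal_cv; congr dart_cv.
  by apply/funext => p; rewrite /= dart_revK.
- apply: dart_mx_unitary => [p q|f].
    rewrite rmorphB rmorphM fmorph_div !rmorph_nat.
    by rewrite [dart_tail q == _]eq_sym [q == p]eq_sym.
  rewrite !coin_cv; congr dart_cv; apply/funext => p.
  set S := \sum_(q | dart_tail q == dart_tail p) f q.
  have -> : \sum_(q | dart_tail q == dart_tail p)
      (2%:R / k%:R * (\sum_(q' | dart_tail q' == dart_tail q) f q') - f q) = S.
    rewrite sumrB.
    under eq_bigr => q /eqP -> do rewrite -/S -[_ * S]mulr1.
    rewrite -mulr_sumr.
    have -> : \sum_(q | dart_tail q == dart_tail p) (1 : C) = k%:R.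
      rewrite -(rmorph_nat (real_complex R)).
      rewrite -(card_darts_from (dart_tail p) X_reg).
      by rewrite rmorph_sum; apply: eq_bigr => q _; rewrite rmorph1.
    by rewrite -/S; field.
  by ring.
- apply: dart_mx_unitary => [p q|f].
    rewrite rmorphM rmorphB rmorphM rmorph1 !rmorph_nat.
    by rewrite [q == p]eq_sym; case: eqP => [->|]//; rewrite !mul0r.
  rewrite !oracle_cv; congr dart_cv; apply/funext => p.
  by case: eqP => _; rewrite /=; ring.
Qed.

End ArcOperators.

(** * Eigenvectors of the walk from eigenfunctions of the graph *)

(** The roots are exp(+- i theta) with cos theta = [mu]. *)
Lemma unit_quadratic_roots (R : realType) (mu : R) : -1 < mu < 1 ->
  exists lam1 lam2 : R[i],
    [/\ lam1 + lam2 = 2%:R * mu%:C%C, lam1 * lam2 = 1, lam1 - lam2 != 0 &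
      Normc.normc (lam1 - lam2) ^+ 2 = 4%:R * (1 - mu ^+ 2)].
Proof.
move=> /andP[mu_gt mu_lt].
have s2_gt0 : 0 < 1 - mu ^+ 2.
  have -> : 1 - mu ^+ 2 = (1 - mu) * (mu + 1) by ring.
  by rewrite mulr_gt0 ?subr_gt0// -(opprK 1) subr_gt0.
pose s := Num.sqrt (1 - mu ^+ 2).
have s_gt0 : 0 < s by rewrite sqrtr_gt0.
have s2E : s ^+ 2 = 1 - mu ^+ 2 by rewrite sqr_sqrtr// ltW.
have gapE : (mu +i* s)%C - (mu -i* s)%C = (0 +i* (s *+ 2))%C.
  by apply/eqP; rewrite eq_complex/= subrr opprK mulr2n !eqxx.
exists (mu +i* s)%C, (mu -i* s)%C; split.
- by rewrite mulr2n mulrDl mul1r; apply/eqP; rewrite eq_complex/= subrr addr0 !eqxx.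
- apply/eqP; rewrite eq_complex/=; apply/andP; split; apply/eqP; last by ring.
  by rewrite mulrN opprK -!expr2 s2E; ring.
- by rewrite gapE eq_complex/= negb_and mulrn_eq0/= (gt_eqF s_gt0) orbT.
- by rewrite gapE /= expr0n add0r sqr_sqrtr ?sqr_ge0// -s2E; ring.
Qed.

Lemma normc_inv_sqrtC (R : realType) (m : nat) :
  Normc.normc ((sqrtC m%:R)^-1 : R[i]) ^+ 2 = m%:R^-1.
Proof.
apply: complexI; rewrite rmorphXn fmorphV rmorph_nat /=.
rewrite -[LHS]/(`|(sqrtC m%:R)^-1 : R[i]| ^+ 2) normfV exprVn -normrX sqrtCK.
exact/congr1/normr_nat.
Qed.

Section WalkEigenvectors.
Variables (R : realType) (X : sgraph) (k : nat) (a : X).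
Hypotheses (k_gt0 : (0 < k)%N) (X_reg : is_regular X k).
Local Notation C := R[i].
Local Notation U := (transition R k a).

Variables (mu : R) (y : X -> R).
Hypotheses (y_a : y a = 0) (y_nbr : forall v, adj a v -> y v = 1).
Hypothesis y_eigen : forall u, u != a ->
  \sum_(w | adj u w) y w = k%:R * mu * y u.

Local Notation tail_lift := (dart_cv (fun p : dart X => (y (dart_tail p))%:C%C)).
Local Notation head_lift := (dart_cv (fun p : dart X => (y (dart_head p))%:C%C)).

Let kC0 : k%:R != 0 :> C. Proof. by rewrite pnatr_eq0 -lt0n. Qed.

Lemma sum_const_darts (u : X) (c : C) :
  \sum_(q : dart X | dart_tail q == u) c = k%:R * c.
Proof.
rewrite -(rmorph_nat (real_complex R)) -(card_darts_from R u X_reg).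
by rewrite rmorph_sum mulr_suml; apply: eq_bigr => q _; rewrite rmorph1 mul1r.
Qed.

(** The tail lift is constant on the arcs leaving a vertex and vanishes on those
    leaving [a], so that coin and oracle fix it. *)
Lemma transition_tail_lift : U *m tail_lift = head_lift.
Proof.
rewrite /transition -!mulmxA oracle_cv coin_cv reversal_cv.
congr dart_cv; apply/funext => p /=; set v := dart_tail _.
have oracle_y u : (1 - 2%:R * (u == a)%:R) * (y u)%:C%C = (y u)%:C%C :> C.
  by case: eqP => [->|_]; rewrite ?y_a ?rmorph0 ?mulr0// subr0 mul1r.
rewrite (eq_bigr (fun=> (y v)%:C%C)) => [|q /eqP ->]; last exact: oracle_y.
rewrite sum_const_darts oracle_y /v -/(dart_head p).
have -> : dart_tail (dart_rev p) = dart_head p by [].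
by field.
Qed.

(** Away from [a] this is the eigenvalue equation. On the arcs leaving [a] the
    oracle turns the value 1 of the head lift into -1 and the coin keeps
    constants, which agrees with [2 mu y a - 1] since [y a = 0]: this is why [y]
    is to vanish at [a] and to be 1 on its neighbours. *)
Lemma transition_head_lift :
  U *m head_lift = (2%:R * mu%:C%C) *: head_lift - tail_lift.
Proof.
rewrite /transition -!mulmxA oracle_cv coin_cv reversal_cv.
have -> : (2%:R * mu%:C%C) *: head_lift - tail_lift =
  dart_cv (fun p : dart X =>
    2%:R * mu%:C%C * (y (dart_head p))%:C%C - (y (dart_tail p))%:C%C).
  by apply/colP => i; rewrite !mxE.
congr dart_cv; apply/funext => p /=; set q := dart_rev p.
have -> : dart_head p = dart_tail q by [].
have -> : dart_tail p = dart_head q by [].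
clearbody q => {p}.
under eq_bigr => r /eqP -> do rewrite /=.
rewrite -mulr_sumr.
rewrite (sum_darts_from (dart_tail q) (fun w => (y w)%:C%C)) -rmorph_sum /=.
have q_adj : adj (dart_tail q) (dart_head q) by exact: (valP q).
have [qa|qa] := eqVneq (dart_tail q) a; last first.
  rewrite y_eigen// !rmorphM /= rmorph_nat; by field.
rewrite qa y_a in q_adj *; rewrite (y_nbr q_adj).
rewrite (eq_bigr (fun=> 1)) => [|v]; last exact: y_nbr.
have -> : \sum_(v | adj a v) (1 : R) = k%:R.
  by rewrite -(sum_darts_from a (fun=> 1 : R)) (card_darts_from R a X_reg).
by rewrite /= rmorph_nat rmorph1 rmorph0; field.
Qed.

(** On the span of the two lifts the walk acts by the companion matrix of the
    polynomial of which [lam] is a root. *)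
Lemma lift_eigenvector (lam : C) : lam ^+ 2 - 2%:R * mu%:C%C * lam + 1 = 0 ->
  U *m (tail_lift - lam *: head_lift) = lam *: (tail_lift - lam *: head_lift).
Proof.
move=> lam_root.
rewrite mulmxBr -scalemxAr transition_tail_lift transition_head_lift.
apply/colP => i; rewrite !mxE.
set h := (y (dart_head _))%:C%C; set t := (y (dart_tail _))%:C%C.
have -> : h - lam * (2%:R * mu%:C%C * h - t) =
  lam * (t - lam * h) + (lam ^+ 2 - 2%:R * mu%:C%C * lam + 1) * h by ring.
by rewrite lam_root mul0r addr0.
Qed.

(** The tail lift is the combination of the eigenvectors for [lam1] and [lam2]
    with coefficients [- lam2 / (lam1 - lam2)] and [lam1 / (lam1 - lam2)], and
    these eigenvectors have entries [- lam1] and [- lam2] on the arcs leaving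
    [a]. As [lam1 * lam2 = 1], each of the two eigenprojections contributes
    [|c|^2 / |lam1 - lam2|^2 = |c|^2 / (4 (1 - mu^2))] on each of the [k]
    arcs. *)
Lemma tail_lift_weight (c : C) : -1 < mu < 1 ->
  block_weight U (fun i => dart_tail (enum_val i) == a) (c *: tail_lift) =
  k%:R * Normc.normc c ^+ 2 / (2%:R * (1 - mu ^+ 2)).
Proof.
move=> mu_lt1.
have s2_gt0 : 0 < 1 - mu ^+ 2.
  have -> : 1 - mu ^+ 2 = (1 - mu) * (mu + 1) by ring.
  move/andP: mu_lt1 => [? ?].
  by rewrite mulr_gt0 ?subr_gt0// -(opprK 1) subr_gt0.
have [lam1 [lam2 [sum_lam prod_lam gap0 gap_norm]]] := unit_quadratic_roots mu_lt1.
have lam12 : lam1 != lam2 by rewrite -subr_eq0.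
have root1 : lam1 ^+ 2 - 2%:R * mu%:C%C * lam1 + 1 = 0.
  by rewrite -sum_lam -prod_lam; ring.
have root2 : lam2 ^+ 2 - 2%:R * mu%:C%C * lam2 + 1 = 0.
  by rewrite -sum_lam -prod_lam; ring.
have U_unitary := transition_unitary R a k_gt0 X_reg.
set v1 := tail_lift - lam1 *: head_lift; set v2 := tail_lift - lam2 *: head_lift.
have eig1 : U *m v1 = lam1 *: v1 by exact: lift_eigenvector.
have eig2 : U *m v2 = lam2 *: v2 by exact: lift_eigenvector.
have liftE : c *: tail_lift =
    (c * - lam2 / (lam1 - lam2)) *: v1 + (c * lam1 / (lam1 - lam2)) *: v2.
  have two_lines (l1 l2 t h : C) : l1 - l2 != 0 ->
      c * t = (c * - l2 / (l1 - l2)) * (t - l1 * h)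
        + (c * l1 / (l1 - l2)) * (t - l2 * h).
    by move=> gap; field.
  rewrite /v1 /v2; move: tail_lift head_lift => t h.
  by apply/colP => i; have := two_lines _ _ (t i 0) (h i 0) gap0; rewrite !mxE.
have [proj1 proj2 proj0] := eigenprojection_sum2 U_unitary lam12 eig1 eig2 liftE.
pose term := Normc.normc c ^+ 2 / (4%:R * (1 - mu ^+ 2)).
have at_a (i : 'I_#|dart X|) lam : dart_tail (enum_val i) == a ->
    (tail_lift - lam *: head_lift) i 0 = - lam.
  move=> /eqP ia; rewrite !mxE ia y_a (_ : y _ = 1) ?mulr1 ?sub0r//.
  apply: y_nbr; rewrite -ia; exact: (valP (enum_val i)).
have entry (i : 'I_#|dart X|) : dart_tail (enum_val i) == a ->
    \sum_(lam \in eigenvalues U)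
      Normc.normc ((eigenprojection U lam *m (c *: tail_lift)) i 0) ^+ 2 =
    term + term.
  move=> ia.
  have lam1_0 : lam1 != 0.
    apply/eqP => l0; move/eqP: prod_lam.
    by rewrite l0 mul0r eq_sym oner_eq0.
  have lam2_0 : lam2 != 0.
    apply/eqP => l0; move/eqP: prod_lam.
    by rewrite l0 mulr0 eq_sym oner_eq0.
  have eigenvalueU lam : lam != 0 ->
      U *m (tail_lift - lam *: head_lift) =
        lam *: (tail_lift - lam *: head_lift) ->
      eigenvalues U lam.
    move=> lam0 eig; apply/eigenvalueP; exists (tail_lift - lam *: head_lift)^T.
      by rewrite -trmx_mul eig linearZ.
    apply/eqP => /matrixP/(_ 0 i); rewrite mxE at_a// mxE => /eqP.
    by rewrite oppr_eq0 (negPf lam0).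
  have normc_entry (z w : C) : z * w = c / (lam1 - lam2) ->
      Normc.normc (z * w) ^+ 2 = term.
    by move=> ->; rewrite Normc.normcM Normc.normcV exprMn exprVn gap_norm.
  have normcN (z : C) : Normc.normc (- z) = Normc.normc z.
    by case: z => z1 z2; rewrite /= !sqrrN.
  pose weight lam :=
    Normc.normc ((eigenprojection U lam *m (c *: tail_lift)) i 0) ^+ 2.
  have scale_entry (z : C) (v : 'cV[C]_#|dart X|) : (z *: v) i 0 = z * v i 0.
    by rewrite mxE.
  have weight1 : weight lam1 = term.
    rewrite /weight proj1 scale_entry /v1 at_a//; apply: normc_entry.
    by rewrite -[RHS]mul1r -prod_lam; ring.
  have weight2 : weight lam2 = term.
    rewrite /weight proj2 scale_entry /v2 at_a// mulrN normcN; apply: normc_entry.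
    by rewrite -[RHS]mul1r -prod_lam; ring.
  have weight0 lam : lam \notin [:: lam1; lam2] -> weight lam = 0.
    by move=> lam_other; rewrite /weight proj0// mxE Normc.normc0 expr0n.
  rewrite -[LHS]/(\sum_(lam \in eigenvalues U) weight lam).
  clearbody weight.
  rewrite -(@fsbig_widen _ _ _ _ [set` [:: lam1; lam2]]); last 2 first.
  - move=> lam /=; rewrite !inE => /orP[] /eqP ->;
      [exact: eigenvalueU lam1_0 eig1|exact: eigenvalueU lam2_0 eig2].
  - by move=> lam [_ /=] /negP lam_other; exact: weight0.
  rewrite -fsbig_seq; last by rewrite /= inE lam12.
  by rewrite !big_cons big_nil /= weight1 weight2 addr0.
rewrite /block_weight (eq_bigr _ entry).
rewrite (big_dart (fun p => dart_tail p == a) (fun=> term + term)).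
rewrite -[term + term]mul1r -mulr_suml (card_darts_from R a X_reg) /term.
by field; rewrite gt_eqF.
Qed.

Lemma sqnorm_initial_state_sub : (0 < #|X|)%N ->
  let c := (sqrtC (#|X| * k)%:R)^-1 : C in
  sqnorm (initial_state R X k - c *: tail_lift) =
  (\sum_u (1 - y u) ^+ 2) / #|X|%:R.
Proof.
move=> n_gt0 /=; set c := _^-1.
have c2 : Normc.normc c ^+ 2 = ((#|X| * k)%:R)^-1 by exact: normc_inv_sqrtC.
rewrite /sqnorm.
have entry (i : 'I_#|dart X|) : 
  Normc.normc ((initial_state R X k - c *: tail_lift) i 0) ^+ 2 =
  ((#|X| * k)%:R)^-1 * (1 - y (dart_tail (enum_val i))) ^+ 2.
  rewrite !mxE -/c -{1}[c]mulr1 -mulrBr Normc.normcM exprMn c2; congr (_ * _).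
  rewrite -(rmorph1 (real_complex R)) -rmorphB /=.
  by rewrite expr0n addr0 sqr_sqrtr// sqr_ge0.
rewrite (eq_bigr _ (fun i _ => entry i)) -mulr_sumr.
rewrite (big_dart xpredT (fun p => (1 - y (dart_tail p)) ^+ 2)).
rewrite (partition_big (@dart_tail X) xpredT)//=.
rewrite (eq_bigr (fun u => k%:R * (1 - y u) ^+ 2)) => [|u _].
  by rewrite -mulr_sumr natrM; field; rewrite !pnatr_eq0 -!lt0n k_gt0 n_gt0.
rewrite (eq_bigr (fun=> 1 * (1 - y u) ^+ 2)) => [|p /eqP ->]; last by rewrite mul1r.
by rewrite -mulr_suml (card_darts_from R u X_reg).
Qed.

End WalkEigenvectors.

(** * Distances and spheres *)

Section Distance.
Variable X : sgraph.
Hypothesis X_conn : is_connected X.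
Implicit Types (u v w : X) (m i : nat).

Lemma walkP m u v :
  reflect (exists p : seq X, [/\ size p = m, path adj u p & last u p = v])
          (walk m u v).
Proof.
apply: (iffP existsP) => [[p /andP[p_path /eqP p_last]]|[p [p_size p_path p_last]]].
  by exists p; rewrite size_tuple.
have p_sizeb : size p == m by apply/eqP.
by exists (Tuple p_sizeb); rewrite /= p_path p_last eqxx.
Qed.

(** A path without repeated vertices has length less than [#|X|], so the search
    defining [dist] succeeds in a connected graph. *)
Lemma walk_dist u v : walk (dist u v) u v.
Proof.
have has_walk : has (fun m => walk m u v) (iota 0 #|X|).
  have /connectP[p p_path ->] := X_conn.2 u v.
  case: (shortenP p_path) => q q_path q_uniq _.
  apply/hasP; exists (size q); last by apply/walkP; exists q.
  rewrite mem_iota add0n leq0n /=.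
  by rewrite -[(size q).+1]/(size (u :: q)) -(card_uniqP q_uniq) max_card.
have := nth_find 0%N has_walk.
by rewrite nth_iota ?add0n// -[X in (_ < X)%N](size_iota 0) -has_find.
Qed.

Lemma dist_le_walk m u v : walk m u v -> (dist u v <= m)%N.
Proof.
move=> m_walk; rewrite leqNgt; apply/negP => m_lt.
have m_card : (m < #|X|)%N.
  by rewrite (leq_trans m_lt)// -[leqRHS](size_iota 0) find_size.
have := before_find 0%N m_lt; rewrite nth_iota// add0n.
by rewrite m_walk.
Qed.

Lemma dist0 u : dist u u = 0%N.
Proof. by apply/eqP; rewrite -leqn0 dist_le_walk//; apply/walkP; exists [::]. Qed.

Lemma dist_eq0 u v : (dist u v == 0%N) = (v == u).
Proof.
apply/eqP/eqP => [uv|->]; last exact: dist0.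
by have /walkP[p []] := walk_dist u v; rewrite uv => /size0nil ->.
Qed.

Lemma dist_adj_le u v w : adj v w -> (dist u w <= (dist u v).+1)%N.
Proof.
move=> vw; apply: dist_le_walk.
have /walkP[p [p_size p_path p_last]] := walk_dist u v.
apply/walkP; exists (rcons p w).
by rewrite size_rcons p_size rcons_path p_path p_last last_rcons.
Qed.

Lemma dist_adj u v w : adj v w ->
  [|| (dist u w).+1 == dist u v, dist u w == dist u v | dist u w == (dist u v).+1].
Proof.
move=> vw; have wv : adj w v by rewrite adj_sym.
have := dist_adj_le u vw; have := dist_adj_le u wv.
by case: ltngtP => //=; lia.
Qed.

Lemma dist_pred u v i : dist u v = i.+1 -> exists2 w, adj v w & dist u w = i.
Proof.
move=> uv; have := walk_dist u v; rewrite uv => /walkP[p].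
case: (lastP p) => [[]//|q w]; rewrite size_rcons rcons_path last_rcons.
case=> -[q_size] /andP[q_path q_last] wv.
exists (last u q); first by rewrite adj_sym -wv.
have q_walk : (dist u (last u q) <= i)%N.
  by apply: dist_le_walk; apply/walkP; exists q.
apply/eqP; rewrite eqn_leq q_walk -ltnS -uv -wv.
exact: dist_adj_le.
Qed.

Lemma dist_le_diameter u v : (dist u v <= diameter X)%N.
Proof.
apply: leq_trans (leq_bigmax_cond _ (isT : predT u)).
exact: (leq_bigmax_cond _ (isT : predT v)).
Qed.

Variables (k : nat) (ai bi ci : nat -> nat).
Hypotheses (X_reg : is_regular X k) (X_int : intersection_numbers X ai bi ci).
Definition sphere_size (o : X) i : nat := #|[set u | dist o u == i]%SET|.
Variable o : X.
Local Notation kk := (sphere_size o).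

Lemma sum_neighbours (V : nmodType) (f : nat -> V) v :
  \sum_(w | adj v w) f (dist o w) =
  f (dist o v).-1 *+ ci (dist o v) + f (dist o v) *+ ai (dist o v)
    + f (dist o v).+1 *+ bi (dist o v).
Proof.
set i := dist o v; have [<- <- <-] := X_int o v; rewrite -/i.
rewrite -!sumr_const (bigID (fun w => (dist o w).+1 == i))/=.
rewrite [X in _ + X](bigID (fun w => dist o w == i))/= addrA.
congr (_ + _ + _); apply: eq_big => w; rewrite ?inE.
- by [].
- by move=> /andP[_ /eqP <-].
- by case: (dist o w =P i) => [->|]; rewrite ?andbF// gtn_eqF// andbT.
- by move=> /andP[_ /eqP ->].
- case: (boolP (adj v w)) => //= /(dist_adj o); rewrite -/i.
  by move=> /or3P[]/eqP; lia.
- move=> /andP[/andP[/(dist_adj o)]]; rewrite -/i.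
  by move=> /or3P[/eqP-> /eqP|/eqP-> _ /eqP|/eqP->].
Qed.

Lemma sphere_gt0P i : reflect (exists v, dist o v = i) (0 < kk i)%N.
Proof.
rewrite /sphere_size; apply: (iffP card_gt0P) => -[v].
  by rewrite inE => /eqP; exists v.
by move=> vi; exists v; rewrite inE; apply/eqP.
Qed.

Lemma degree_split v : (ci (dist o v) + ai (dist o v) + bi (dist o v))%N = k.
Proof.
rewrite -(X_reg v) cardsE -sum1_card.
apply: (mulrIn (oner_neq0 int)); rewrite natr_sum.
have := sum_neighbours (fun=> 1 : int) v; rewrite !natrD => <-.
by apply: eq_bigl.
Qed.

(** Both sides count the edges between two consecutive spheres. *)
Lemma sphere_edges i : (kk i * bi i = kk i.+1 * ci i.+1)%N.
Proof.
have sphere_const j (F : X -> nat) c : (forall v, dist o v = j -> F v = c) ->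
    (\sum_(v | dist o v == j) F v = kk j * c)%N.
  move=> Fc; rewrite (eq_bigr (fun=> c)) => [|v /eqP]; last exact: Fc.
  by rewrite /sphere_size -sum_nat_const; apply: eq_bigl => v; rewrite inE.
rewrite -(sphere_const i
  (fun v => \sum_(w | (dist o w == i.+1) && adj v w) 1)%N) => [|v vi].
  rewrite (exchange_big_dep (fun w => dist o w == i.+1))/=; last first.
    by move=> ? ? _ /andP[].
  apply: sphere_const => w wi; have [ciE _ _] := X_int o w.
  rewrite -wi -ciE wi sum1dep_card; apply: eq_card => v; rewrite !inE eqSS adj_sym.
  by rewrite eqxx andbC.
have [_ _ biE] := X_int o v; rewrite -vi -biE vi sum1dep_card.
by apply: eq_card => w; rewrite !inE andbC.
Qed.

Lemma sphere0 : kk 0 = 1%N.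
Proof.
rewrite -(cards1 o) /sphere_size; apply: eq_card => v.
by rewrite !inE dist_eq0.
Qed.

Lemma b0E : bi 0 = k.
Proof.
rewrite -(X_reg o); have [_ _] := X_int o o; rewrite dist0 => <-.
apply: eq_card => w; rewrite !inE; case: (boolP (adj o w)) => //= ow.
have := dist_adj o ow; rewrite dist0 orFb dist_eq0.
by case: eqP => // wo; move: ow; rewrite wo adj_irrefl.
Qed.

Lemma ci_gt0 i : (0 < kk i.+1)%N -> (0 < ci i.+1)%N.
Proof.
move=> /sphere_gt0P[v vi]; have [ciE _ _] := X_int o v.
have [w vw wi] := dist_pred vi.
by rewrite -vi -ciE; apply/card_gt0P; exists w; rewrite inE vw wi vi eqxx.
Qed.

Lemma sphere_growth i : (kk i.+1 <= kk i * k)%N.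
Proof.
have [->//|kS_gt0] := posnP (kk i.+1).
have c_gt0 := ci_gt0 kS_gt0.
have : (0 < kk i * bi i)%N by rewrite sphere_edges muln_gt0 kS_gt0.
rewrite muln_gt0 => /andP[/sphere_gt0P[v vi] _].
apply: (@leq_trans (kk i.+1 * ci i.+1)); first by rewrite leq_pmulr.
by rewrite -sphere_edges leq_mul2l -(degree_split v) vi leq_addl orbT.
Qed.

Lemma sphere_le i : (kk i <= k ^ i)%N.
Proof.
elim: i => [|i IH]; first by rewrite sphere0.
by apply: leq_trans (sphere_growth i) _; rewrite expnSr leq_mul2r IH orbT.
Qed.

Lemma last_sphere_le i d : (i <= d)%N -> (kk d <= kk i * k ^ (d - i))%N.
Proof.
move=> id; rewrite -{1}(subnKC id); elim: (d - i)%N => [|j IH].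
  by rewrite addn0 muln1.
rewrite addnS (leq_trans (sphere_growth _))// expnSr mulnA.
by rewrite leq_mul2r IH orbT.
Qed.

Variable d : nat.
Hypothesis X_diam : diameter X = d.

Lemma sphere_past_diameter i : (d < i)%N -> kk i = 0%N.
Proof.
move=> di; apply/eqP; rewrite -leqn0 leqNgt; apply/negP => /sphere_gt0P[v vi].
by have := dist_le_diameter o v; rewrite vi X_diam leqNgt di.
Qed.

(** If [k ^ d.-1] is small against the number of vertices, nearly all vertices
    are therefore in the last sphere. *)
Lemma card_vertices_le : (0 < k)%N -> (#|X| <= d * k ^ d.-1 + kk d)%N.
Proof.
move=> k_gt0.
have -> : #|X| = (\sum_(i < d.+1) kk i)%N.
  rewrite -sum1_card (partition_big (fun u => inord (dist o u) : 'I_d.+1) xpredT)//=.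
  apply: eq_bigr => i _; rewrite /sphere_size -sum1_card; apply: eq_bigl => u.
  rewrite inE -val_eqE /= inordK// ltnS -X_diam.
  exact: dist_le_diameter.
rewrite big_ord_recr/= leq_add2r.
apply: (@leq_trans (\sum_(i < d) k ^ d.-1)); last by rewrite sum_nat_const card_ord.
apply: leq_sum => i _; apply: leq_trans (sphere_le i) _.
rewrite leq_pexp2l// -ltnS prednK// (leq_trans _ (ltn_ord i))//.
Qed.

End Distance.

(** * The ground state of a distance regular graph *)

Section GroundState.
Variables (R : realType) (X : sgraph) (k d : nat) (ai bi ci : nat -> nat).
Hypotheses (X_conn : is_connected X) (X_reg : is_regular X k).
Hypotheses (X_int : intersection_numbers X ai bi ci) (X_diam : diameter X = d).
Hypotheses (k_gt0 : (0 < k)%N) (d_gt0 : (0 < d)%N).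
Variable o : X.
Local Notation kk := (sphere_size o).
Hypothesis kd_gt0 : (0 < kk d)%N.

Let kR0 : k%:R != 0 :> R. Proof. by rewrite pnatr_eq0 -lt0n. Qed.

(** A function of the distance from [o] satisfies the eigenvalue equation of the
    random walk away from [o] iff its values satisfy that of the path whose vertices carry the
    sphere sizes as weights and whose conductances are the numbers of edges
    between consecutive spheres, divided by [k]. Past the first step these
    conductances are at least [sphere_size o d / k ^ d.-1], which bounds the
    growth of the ground state. *)
Lemma radial_ground_state :
  exists (eps : R) (y : X -> R),
    [/\ 0 < eps, y o = 0, (forall v, adj o v -> y v = 1),
      (forall u, u != o -> \sum_(w | adj u w) y w = k%:R * (1 - eps) * y u) &
      (forall u, u != o ->
        1 <= y u <= 1 + d%:R * (k%:R ^+ d.-1 / (kk d)%:R))].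
Proof.
have sphere_gt0 i : (i <= d)%N -> (0 < kk i)%N.
  move=> id; have := leq_trans kd_gt0 (last_sphere_le X_conn X_reg X_int o id).
  by rewrite muln_gt0 => /andP[].
pose w i : R := (kk i)%:R; pose g i : R := (kk i * ci i)%:R / k%:R.
have gS i : g i.+1 = (kk i * bi i)%:R / k%:R.
  by rewrite /g (sphere_edges X_int o i).
have w_gt0 i : (i <= d)%N -> 0 < w i by move=> id; rewrite ltr0n sphere_gt0.
have g_gt0 i : (1 <= i <= d)%N -> 0 < g i.
  case: i => // i id; rewrite divr_gt0 ?ltr0n// muln_gt0 sphere_gt0//=.
  by apply: (ci_gt0 X_conn X_int (o := o)); exact: sphere_gt0.
have g1 : g 1%N = 1.
  by rewrite gS (sphere0 X_conn) (b0E X_conn X_reg X_int o) mul1n divff.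
have gd1 : g d.+1 = 0.
  by rewrite /g (sphere_past_diameter o X_diam)// mul0n mul0r.
have [eps [z [eps_gt0 z0 z1 z_step z_flux]]] :=
  exists_ground_state d_gt0 (fun i id => w_gt0 i (andP id).2) g_gt0 g1 gd1.
set eta := k%:R ^+ d.-1 / (kk d)%:R.
have eta_ge0 : 0 <= eta by rewrite divr_ge0 ?exprn_ge0 ?ler0n.
have g_inv i : (1 <= i < d)%N -> (g i.+1)^-1 <= eta.
  move=> /andP[i_gt0 id]; rewrite /g /eta invf_div.
  have k_le := last_sphere_le X_conn X_reg X_int o id.
  have c_ge1 : (0 < ci i.+1)%N.
    by apply: (ci_gt0 X_conn X_int (o := o)); exact: sphere_gt0.
  rewrite ler_pdivrMr ?ltr0n ?muln_gt0 ?sphere_gt0// mulrAC ler_pdivlMr ?ltr0n//.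
  rewrite -natrX -!natrM ler_nat.
  apply: (@leq_trans (k * (kk i.+1 * k ^ (d - i.+1)))).
    by rewrite leq_mul2l k_le orbT.
  rewrite mulnCA -expnS mulnC; apply: leq_mul; last by rewrite leq_pmulr.
  by rewrite leq_pexp2l//; lia.
have z_bounds i : (1 <= i <= d)%N -> 1 <= z i <= 1 + i%:R * eta.
  elim: i => [//|[|i] IH id].
    by rewrite z1 lexx lerDl mulr_ge0.
  have /andP[z_ge z_le] := IH (ltnW id).
  have /andP[step_ge step_le] := z_step i.+1 id.
  rewrite (le_trans z_ge step_ge) (le_trans step_le)//.
  apply: le_trans (lerD z_le (g_inv i.+1 id)) _.
  by rewrite -addrA lerD2l -[in leRHS]addn1 natrD mulrDl mul1r.
have dist_range u : u != o -> (1 <= dist o u <= d)%N.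
  by rewrite lt0n (dist_eq0 X_conn) -X_diam dist_le_diameter andbT.
exists eps, (fun u => z (dist o u)); split=> //.
- by rewrite dist0.
- move=> v ov; have := dist_adj X_conn o ov; rewrite dist0/= (dist_eq0 X_conn).
  case/orP => /eqP; last by move->.
  by move=> vo; move: ov; rewrite vo adj_irrefl.
- move=> u uo; rewrite (sum_neighbours X_conn X_int o z).
  have flux := z_flux _ (dist_range u uo).
  have kE := degree_split X_conn X_reg X_int o u.
  have ki_gt0 := sphere_gt0 _ (andP (dist_range u uo)).2.
  move: flux kE ki_gt0; set i := dist o u => flux kE ki_gt0.
  have kiR0 : (kk i)%:R != 0 :> R by rewrite pnatr_eq0 -lt0n.
  have {kE} kE : (ci i)%:R + (ai i)%:R + (bi i)%:R = k%:R :> R by rewrite -!natrD kE.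
  have {flux} flux : (ci i)%:R * (z i - z i.-1) - (bi i)%:R * (z i.+1 - z i) =
      k%:R * eps * z i.
    apply: (mulfI kiR0); apply: (mulIf (invr_neq0 kR0)).
    move: flux; rewrite gS /g /w !natrM => flux.
    transitivity (eps * (kk i)%:R * z i); last by field.
    by rewrite -flux; ring.
  rewrite -(mulr_natr (z i.-1)) -(mulr_natr (z i)) -(mulr_natr (z i.+1)).
  rewrite mulrBr mulr1 mulrBl -flux -kE; ring.
- move=> u uo; have /andP[u_ge u_le] := dist_range u uo.
  have /andP[-> z_le] /= := z_bounds _ (dist_range u uo).
  by rewrite (le_trans z_le)// lerD2l ler_wpM2r// ler_nat.
Qed.

End GroundState.

(** * The search probability *)

Section QuantitativeBound.
Variables (R : realType) (X : sgraph) (k d : nat) (ai bi ci : nat -> nat).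
Hypotheses (X_conn : is_connected X) (X_reg : is_regular X k).
Hypotheses (X_int : intersection_numbers X ai bi ci) (X_diam : diameter X = d).
Hypotheses (k_gt0 : (0 < k)%N) (d_gt0 : (0 < d)%N).

(** The eigenvalue equation fails only at [a], where its left side is [k] and its
    right side 0. In the sum over all vertices, the left sides add up to [k]
    times the sum of [y]. *)
Lemma eigen_mass (a : X) (eps : R) (y : X -> R) :
  y a = 0 -> (forall v, adj a v -> y v = 1) ->
  (forall u, u != a -> \sum_(w | adj u w) y w = k%:R * (1 - eps) * y u) ->
  eps * \sum_(u | u != a) y u = 1.
Proof.
move=> y_a y_nbr y_eigen; set S := \sum_(u | _) _.
have degree (v : X) : \sum_(w | adj v w) (1 : R) = k%:R.
  by rewrite -(sum_darts_from v (fun=> 1 : R)) (card_darts_from R v X_reg).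
have total : \sum_u \sum_(w | adj u w) y w = k%:R * S.
  rewrite (exchange_big_dep xpredT)//= (bigD1 a)//= y_a big1// add0r mulr_sumr.
  apply: eq_bigr => w _; rewrite -(degree w) mulr_suml; apply: eq_big => v.
    exact: adj_sym.
  by rewrite mul1r.
move: total; rewrite (bigD1 a)//= (eq_bigr (fun=> 1)) => [|v]; last exact: y_nbr.
rewrite degree (eq_bigr _ y_eigen) -mulr_sumr -/S => total.
have kR0 : k%:R != 0 :> R by rewrite pnatr_eq0 -lt0n.
apply: (mulfI kR0); rewrite mulr1 -[RHS](addrK (k%:R * (1 - eps) * S)) total.
by ring.
Qed.

(** The weight of the approximating state has this form with
    [E = #|X| * eps]. *)
Lemma inverse_near_quarter (x E eps : R) :
  x <= 10%:R^-1 -> 1 - x <= E <= 1 + x -> 0 < eps <= x ->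
  `|(2%:R * (E * (2%:R - eps)))^-1 - 4%:R^-1| <= x.
Proof.
move=> x_le /andP[E_ge E_le] /andP[eps_gt0 eps_le].
have x_gt0 : 0 < x by lra.
set q := E * (2%:R - eps).
have q_ge : 2%:R - 3%:R * x <= q by rewrite /q; nra.
have q_le : q <= 2%:R + 2%:R * x by rewrite /q; nra.
have q_gt0 : 0 < q by lra.
have -> : (2%:R * q)^-1 - 4%:R^-1 = (2%:R - q) / (4%:R * q).
  by field; rewrite gt_eqF.
rewrite normrM normfV [`|4%:R * q|]gtr0_norm; last by lra.
rewrite ler_pdivrMr; last by lra.
by rewrite ler_norml; apply/andP; split; nra.
Qed.

(** With [x] as below, the ground state lies between 1 and [1 + x] outside [a],
    which gives [eps <= x] and places [#|X| * eps] between [1 - x] and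
    [1 + x]. The approximating state [z] then has a weight within [x] of 1/4,
    and its square distance [rho] from the initial state is at most [2 x]. *)
Lemma search_probability_near_quarter (a : X) (t : R) :
  let x := 2%:R * d%:R * (k%:R ^+ d.-1 / #|X|%:R) : R in
  x <= 10%:R^-1 -> 0 < t ->
  `|average_search_probability R k a - 4%:R^-1| <=
    2%:R * t + (3%:R + 2%:R * t^-1) * x.
Proof.
move=> x x_le t_gt0.
set p := average_search_probability R k a.
pose N : R := #|X|%:R.
have N_gt0 : 0 < N by rewrite ltr0n X_conn.1.
pose DK : R := d%:R * k%:R ^+ d.-1.
have DK_ge1 : 1 <= DK.
  rewrite /DK -natrX -natrM (ler_nat _ 1) muln_gt0 d_gt0 expn_gt0 k_gt0//.
have xN : x * N = 2%:R * DK by rewrite /x /DK -/N; field; rewrite gt_eqF.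
have x_gt0 : 0 < x by rewrite -(pmulr_lgt0 _ N_gt0) xN; lra.
have kd_ge : N - DK <= (sphere_size a d)%:R.
  rewrite lerBlDl /N /DK -natrX -natrM -natrD ler_nat.
  exact: (card_vertices_le X_conn X_reg X_int).
have N_ge : 20%:R * DK <= N by nra.
have kd_gt0 : (0 < sphere_size a d)%N by rewrite -(ltr0n R); lra.
have [eps [y [eps_gt0 y_a y_nbr y_eigen y_bounds]]] :=
  radial_ground_state R X_conn X_reg X_int X_diam k_gt0 d_gt0 kd_gt0.
have mass := eigen_mass y_a y_nbr y_eigen.
have eta_le : d%:R * (k%:R ^+ d.-1 / (sphere_size a d)%:R) <= x.
  rewrite mulrA -/DK ler_pdivrMr ?ltr0n//; nra.
have card_compl : (#|predC1 a|)%:R = N - 1 :> R.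
  rewrite /N -(prednK X_conn.1) cardC1 -[in RHS]natr1; lra.
have sum_ge : N - 1 <= \sum_(u | u != a) y u.
  rewrite -card_compl -sum1_card natr_sum; apply: ler_sum => u ua.
  by have /andP[] := y_bounds u ua.
have sum_le : \sum_(u | u != a) y u <= (N - 1) * (1 + x).
  rewrite -card_compl -sum1_card natr_sum mulr_suml; apply: ler_sum => u ua.
  rewrite mul1r; have /andP[_ y_le] := y_bounds u ua; lra.
have rho_le : (\sum_u (1 - y u) ^+ 2) / N <= 2%:R * x.
  rewrite (bigD1 a)//= y_a subr0 expr1n ler_pdivrMr//.
  have dev_le : \sum_(u | u != a) (1 - y u) ^+ 2 <= (N - 1) * x ^+ 2.
    rewrite -card_compl -sum1_card natr_sum mulr_suml; apply: ler_sum => u ua.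
    rewrite mul1r; have /andP[y_ge y_le] := y_bounds u ua; nra.
  nra.
have E_bounds : 1 - x <= N * eps <= 1 + x by apply/andP; split; nra.
have eps_le : eps <= x by nra.
have mu_bounds : -1 < 1 - eps < 1 by apply/andP; split; lra.
pose c : R[i] := (sqrtC (#|X| * k)%:R)^-1.
have unitary := transition_unitary R a k_gt0 X_reg.
pose Q (i : 'I_#|dart X|) := dart_tail (enum_val i) == a.
pose x0 := initial_state R X k.
pose z := c *: dart_cv (fun e : dart X => (y (dart_tail e))%:C%C).
pose rho : R := (\sum_u (1 - y u) ^+ 2) / N.
have rhoE : sqnorm (x0 - z) = rho.
  exact: (sqnorm_initial_state_sub k_gt0 X_reg y X_conn.1).
have zE : block_weight (transition R k a) Q z =
    (2%:R * (N * eps * (2%:R - eps)))^-1.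
  rewrite (tail_lift_weight k_gt0 X_reg y_a y_nbr y_eigen c mu_bounds).
  rewrite normc_inv_sqrtC natrM -/N; field.
  have eps2 : 0 < 2%:R - eps by lra.
  have mu2 : 0 < 1 - (1 - eps) ^+ 2 by nra.
  by apply/and5P; split; rewrite gt_eqF ?ltr0n ?X_conn.1.
have p_le s : 0 < s -> p <= (1 + s) * block_weight (transition R k a) Q z
    + (1 + s^-1) * rho.
  move=> s_gt0; rewrite -rhoE.
  have := block_weight_perturb Q z (x0 - z) unitary s_gt0.
  by rewrite addrC subrK.
have p_ge : block_weight (transition R k a) Q z <= (1 + t) * p + (1 + t^-1) * rho.
  have := block_weight_perturb Q x0 (z - x0) unitary t_gt0.
  by rewrite addrC subrK -opprB sqnormN rhoE.
have := inverse_near_quarter x_le E_bounds (introT andP (conj eps_gt0 eps_le)).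
rewrite -zE; move: (block_weight _ _ z) p_le p_ge => p' p_le p_ge p'_near.
have p_le2 := p_le 1 ltr01.
have p_let := p_le t t_gt0.
rewrite invr1 in p_le2.
have t_inv : 0 < t^-1 by rewrite invr_gt0.
rewrite -/rho in rho_le.
have rho_ge0 : 0 <= rho.
  by rewrite divr_ge0 ?(ltW N_gt0)// sumr_ge0// => u _; exact: sqr_ge0.
move: p'_near; rewrite !ler_norml => /andP[p'_ge p'_le].
(* [p <= 2 p' + 2 rho] bounds [p], which the lower estimate multiplies by [t] *)
have p_small : p <= 2%:R by lra.
have cross : t^-1 * rho <= t^-1 * (2%:R * x) by rewrite ler_pM2l.
have tp_le : t * p <= t * 2%:R by rewrite ler_pM2l.
have tp'_le : t * p' <= t * 2%:R by rewrite ler_pM2l//; lra.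
rewrite !mulrDl !mul1r in p_ge p_let; rewrite mulrDl.
by apply/andP; split; lra.
Qed.

End QuantitativeBound.

(** * The limit *)

Theorem theorem8p6 (R : realType) (d : nat) (S : set R) (X : R -> sgraph)
  (n k : R -> nat) (ai bi ci : R -> nat -> nat) (a : forall tau : R, X tau) :
  (3 <= d)%N ->
  (forall tau, S tau -> 0 < tau) ->
  ~ has_ubound S ->
  (forall tau, S tau -> distance_regular (X tau)) ->
  (forall tau, S tau -> diameter (X tau) = d) ->
  (forall tau, S tau -> #|X tau| = n tau) ->
  (forall tau, S tau -> is_regular (X tau) (k tau)) ->
  (forall tau, S tau ->
     intersection_numbers (X tau) (ai tau) (bi tau) (ci tau)) ->
  (forall sigma tau, S sigma -> S tau -> sigma <= tau ->
     (k sigma <= k tau)%N) ->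
  k tau @[tau --> within S +oo] --> \oo ->
  ((k tau)%:R ^+ d.-1 / (n tau)%:R : R) @[tau --> within S +oo] --> (0 : R) ->
  average_search_probability R (k tau) (a tau) @[tau --> within S +oo]
    --> (4%:R^-1 : R).
Proof.
move=> d_ge3 _ _ X_dr X_diam X_card X_reg X_int _ k_infty ratio_0.
have d_gt0 : (0 < d)%N by exact: leq_trans d_ge3.
apply/cvgrPdist_le => e e_gt0.
(* the two terms of the bound are to be at most [e / 2] each *)
pose t : R := e / 4%:R; pose K : R := 2%:R * d%:R * (3%:R + 2%:R * t^-1).
have t_gt0 : 0 < t by rewrite divr_gt0.
have K_gt0 : 0 < K.
  by rewrite !mulr_gt0 ?ltr0n// addr_gt0// mulr_gt0// invr_gt0.
pose delta : R := Num.min (10%:R^-1 / (2%:R * d%:R)) (e / 2%:R / K).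
have dR : 0 < 2%:R * d%:R :> R by rewrite mulr_gt0 ?ltr0n.
have delta_gt0 : 0 < delta.
  by rewrite lt_min; apply/andP; split; rewrite !divr_gt0// invr_gt0 ltr0n.
have k_pos : \forall tau \near within S +oo, (0 < k tau)%N.
  exact: (k_infty _ (nbhs_infty_gt 0%N)).
have ratio_small : \forall tau \near within S +oo,
    (k tau)%:R ^+ d.-1 / (n tau)%:R <= delta :> R.
  move/cvgrPdist_le: ratio_0 => /(_ delta delta_gt0); apply: filterS => tau.
  by rewrite sub0r normrN; exact/le_trans/ler_norm.
have in_S : \forall tau \near within S +oo, S tau by exact: withinT.
near=> tau.
have tauS : S tau by near: tau.
have ratio_le : (k tau)%:R ^+ d.-1 / #|X tau|%:R <= delta :> R.
  by rewrite (X_card _ tauS); near: tau.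
have k_gt0 : (0 < k tau)%N by near: tau.
have [X_conn _] := X_dr _ tauS.
move: ratio_le; rewrite le_min => /andP[le1 le2].
rewrite distrC.
have x_le : 2%:R * d%:R * ((k tau)%:R ^+ d.-1 / #|X tau|%:R) <= 10%:R^-1 :> R.
  by rewrite mulrC -ler_pdivlMr.
apply: le_trans (search_probability_near_quarter X_conn (X_reg _ tauS)
  (X_int _ tauS) (X_diam _ tauS) k_gt0 d_gt0 (a tau) x_le t_gt0) _.
rewrite mulrA [_ * (2%:R * d%:R)]mulrC -/K.
move: le2; rewrite ler_pdivlMr// mulrC => le2.
by rewrite /t; lra.
Unshelve. all: by end_near.
Qed.
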